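(* Let $n\ge2$ and $0\le m\le 2n-2$. Let $A\in\mathrm{SL}(2,\mathbb{Z})$ be hyperbolic and of the form $A=T^{k_1}ST^{k_2}S\cdots T^{k_q}S$ with integers $k_1,\dots,k_q\ge2$. Then $$\Psi_n^{(m)}(A)=\mathrm{u}(A)^{1-n}\sum_{j=1}^{q}\sum_{r=0}^{2n-2}\Big[\binom{r}{m^*}\beta_{r-m^*}-\binom{r^*}{m}\beta_{r^*-m}-(-1)^m\binom{r}{m}\beta_{r-m}+(-1)^m\binom{r^*}{m^*}\beta_{r^*-m^*}-(-1)^m\binom{r}{m}\frac{k_j^{\,r-m+1}}{r-m+1}+\binom{r}{m^*}\frac{k_j^{\,r-m^*+1}}{r-m^*+1}\Big]f_r(A_j).$$
   Context: $T=\begin{pmatrix}1&1\\0&1\end{pmatrix}$, $S=\begin{pmatrix}0&-1\\1&0\end{pmatrix}$, $V=\begin{pmatrix}1&0\\1&1\end{pmatrix}$. Write $r^*=2n-2-r$ for integers $r$. Bernoulli numbers $B_j$ satisfy $t/(e^t-1)=\sum_j B_jt^j/j!$ and $\beta_i=(-1)^iB_{i+1}/(i+1)$ for $i\ge0$; any term in the bracket whose binomial coefficient vanishes (in particular whenever the index of $\beta$ or the denominator $r-m+1$, $r-m^*+1$ would be $\le 0$ resp. negative) is taken to be $0$. For $B=\begin{pmatrix}a&b\\c&d\end{pmatrix}\in\mathrm{SL}(2,\mathbb{Z})$: $\mathrm{u}(B)=\gcd(b,c,d-a)$, and $f_r(B)$ is the coefficient of $z^r$ in $(cz^2+(d-a)z-b)^{n-1}$.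 The matrices $A_j$ are defined by $A_1=A$ and $A_{j+1}=(T^{k_j}S)^{-1}A_jT^{k_j}S$ for $1\le j\le q$ (so $A_{q+1}=A_1$). The symbol $\Psi_n^{(m)}$ is defined as follows: one has $T^{-1}AT=T^{k_1-2}VT^{k_2-2}V\cdots T^{k_q-2}V$, a word $X_1X_2\cdots X_p$ in the letters $T,V$ with $p=\sum_j(k_j-1)$. Set $\tilde A_1=T^{-1}AT$ and $\tilde A_{i+1}=X_i^{-1}\tilde A_iX_i$ for $1\le i<p$ (the cyclic permutations of the word). Then $\Psi_n^{(m)}(A)=\mathrm{u}(A)^{1-n}\sum_{i=1}^{p}\big(f_{m^*}(\tilde A_i)-(-1)^mf_m(\tilde A_i)\big)$. *)

(* Defs.v *)
From HB Require Import structures.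
From mathcomp Require Import all_boot all_order all_algebra.

Set Implicit Arguments.
Unset Strict Implicit.
Unset Printing Implicit Defensive.

Import Order.TTheory GRing.Theory Num.Theory.
Local Open Scope ring_scope.

(* Formal power series over rat are represented by their coefficient
   sequences nat -> rat. *)
Definition fps_mul (a b : nat -> rat) (n : nat) : rat :=
  \sum_(i < n.+1) a i * b (n - i)%N.

(* The first n coefficients of 1 / a, for a 0 != 0. *)
Fixpoint fps_inv_seq (a : nat -> rat) (n : nat) : seq rat :=
  if n is n'.+1 then
    let s := fps_inv_seq a n' in
    rcons s (((n' == 0%N)%:R - \sum_(i < n') s`_i * a (n' - i)%N) / a 0%N)
  else [::].

Definition fps_inv (a : nat -> rat) (n : nat) : rat := (fps_inv_seq a n.+1)`_n.

Lemma size_fps_inv_seq a n : size (fps_inv_seq a n) = n.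
Proof. by elim: n => //= n IHn; rewrite size_rcons IHn. Qed.

Lemma nth_fps_inv_seq a n i : (i < n)%N -> (fps_inv_seq a n)`_i = fps_inv a i.
Proof.
elim: n => // n IHn; rewrite ltnS leq_eqVlt => /orP[/eqP-> //|lt_in].
by rewrite /= nth_rcons size_fps_inv_seq lt_in IHn.
Qed.

Lemma fps_mulVr a n :
  a 0%N != 0 -> fps_mul (fps_inv a) a n = (n == 0%N)%:R.
Proof.
move=> a0; rewrite /fps_mul big_ord_recr /= subnn {2}/fps_inv /=.
rewrite nth_rcons size_fps_inv_seq ltnn eqxx divfK //.
rewrite [X in X + _](eq_bigr (fun i : 'I_n =>
  (fps_inv_seq a n)`_i * a (n - i)%N)); first by rewrite addrC subrK.
by move=> i _; rewrite nth_fps_inv_seq.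
Qed.

(* t / (e^t - 1) is the inverse of (e^t - 1) / t = \sum_j t^j / (j + 1)!;
   in particular bernoulli 1 = - 1 / 2. *)
Definition bernoulli (j : nat) : rat :=
  j`!%:R * fps_inv (fun i => (i.+1)`!%:R^-1) j.

(* (\sum_j B_j t^j / j!) * (e^t - 1) = t *)
Lemma bernoulli_egf n :
  fps_mul (fun j => bernoulli j / j`!%:R)
          (fun j => j`!%:R^-1 - (j == 0%N)%:R) n = (n == 1%N)%:R.
Proof.
case: n => [|n]; first by rewrite /fps_mul big_ord1 fact0 invr1 subrr mulr0.
rewrite /fps_mul big_ord_recr /= subnn fact0 invr1 subrr mulr0 addr0.
rewrite eqSS -(@fps_mulVr (fun i => (i.+1)`!%:R^-1)) ?invr1 ?oner_eq0 //.
apply: eq_bigr => i _; have le_in : (i <= n)%N by rewrite -ltnS.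
rewrite subSn //= subr0; congr (_ * _); rewrite /bernoulli mulrC mulKf //.
by rewrite pnatr_eq0 -lt0n fact_gt0.
Qed.

Definition beta (i : nat) : rat := (-1) ^+ i * bernoulli i.+1 / i.+1%:R.

(* Natural-number subtraction is exact, as star is only used for
   r <= 2 n - 2. *)
Definition star (n r : nat) : nat := (2 * n - 2 - r)%N.

Definition mx22 (a b c d : int) : 'M[int]_2 :=
  \matrix_(i < 2, j < 2)
    if i == 0 then (if j == 0 then a else b) else (if j == 0 then c else d).

Definition Tm : 'M[int]_2 := mx22 1 1 0 1.
Definition Sm : 'M[int]_2 := mx22 0 (-1) 1 0.
Definition Vm : 'M[int]_2 := mx22 1 0 1 1.

Definition hyperbolic (A : 'M[int]_2) : Prop := 2 < `|\tr A|.

Definition u (B : 'M[int]_2) : int :=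
  gcdz (gcdz (B 0 1) (B 1 0)) (B 1 1 - B 0 0).

Definition f (n r : nat) (B : 'M[int]_2) : int :=
  (((B 1 0)%:P * 'X^2 + (B 1 1 - B 0 0)%:P * 'X - (B 0 1)%:P) ^+ (n - 1))`_r.

(* With 0-based indices: conj_iter Xs A 0 = A, and conj_iter Xs A i.+1 is the
   conjugate of conj_iter Xs A i by the i-th matrix of Xs. *)
Fixpoint conj_iter (Xs : seq 'M[int]_2) (A : 'M[int]_2) (i : nat) : 'M[int]_2 :=
  if i is i'.+1 then (Xs`_i')^-1 * conj_iter Xs A i' * Xs`_i' else A.

Definition TS_factors (ks : seq nat) : seq 'M[int]_2 :=
  [seq Tm ^+ k * Sm | k <- ks].

Definition TV_word (ks : seq nat) : seq 'M[int]_2 :=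
  flatten [seq rcons (nseq (k - 2) Tm) Vm | k <- ks].

(* Psi_n^(m)(A), where w is the word X_1 ... X_p in T and V that represents
   T^-1 A T; see TV_wordP. *)
Definition Psi (n m : nat) (A : 'M[int]_2) (w : seq 'M[int]_2) : rat :=
  (u A)%:~R ^ (1 - n%:Z) *
  \sum_(i < size w)
    (f n (star n m) (conj_iter w (Tm^-1 * A * Tm) i)
     - (-1) ^+ m * f n m (conj_iter w (Tm^-1 * A * Tm) i))%:~R.

Lemma mx22_mul a b c d a' b' c' d' :
  mx22 a b c d * mx22 a' b' c' d' =
  mx22 (a * a' + b * c') (a * b' + b * d') (c * a' + d * c') (c * b' + d * d').
Proof.
apply/matrixP => i j; rewrite !mxE !big_ord_recl big_ord0 addr0 !mxE /=.
by case: (i == 0); case: (j == 0).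
Qed.

Lemma Tm_unit : Tm \is a GRing.unit.
Proof.
apply/unitrP; exists (mx22 1 (-1) 0 1); rewrite /Tm !mx22_mul.
by split; apply/matrixP => i j; rewrite !mxE /=;
  case: i => -[|[|[]]] // ?; case: j => -[|[|[]]].
Qed.

Lemma size_TV_word ks : size (TV_word ks) = (\sum_(k <- ks) (k - 2).+1)%N.
Proof.
elim: ks => [|k ks IHks]; first by rewrite big_nil.
by rewrite big_cons -IHks /TV_word /= size_cat size_rcons size_nseq.
Qed.

Lemma TV_wordP ks : all (leq 2) ks ->
  Tm^-1 * (\prod_(X <- TS_factors ks) X) * Tm = \prod_(X <- TV_word ks) X.
Proof.
have TST : Tm * Sm * Tm = Vm.
  by rewrite /Tm /Sm !mx22_mul.
elim: ks => [_|k ks IHks /= /andP[k2 /IHks{}IHks]].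
  by rewrite !big_nil mulr1 mulVr // Tm_unit.
rewrite /TV_word /= big_cat /= -/(TV_word ks) -IHks big_cons.
rewrite -cats1 big_cat /= big_seq1 big_nseq -TST.
have ->: iter (k - 2) ( *%R Tm) 1 = Tm ^+ (k - 2).
  by elim: (k - 2)%N => //= i ->; rewrite exprS.
have {1}-> : k = (k - 2).+2 by rewrite -addn2 subnK.
rewrite exprSr exprS !mulrA mulVr ?Tm_unit // mul1r.
by rewrite mulrK ?Tm_unit.
Qed.

(* Main.v *)
From HB Require Import structures.
Require Import Defs.
From mathcomp Require Import all_boot all_order all_algebra.
From mathcomp Require Import ring zify.

Set Implicit Arguments.
Unset Strict Implicit.
Unset Printing Implicit Defensive.

Import Order.TTheory GRing.Theory Num.Theory.
Local Open Scope ring_scope.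

(* Conjugation by g acts on the quadratic form c z^2 + (d - a) z - b of a matrix
   by the substitution z |-> g z. Up to a shift by T, the letters of the word
   coming from T^k_j S are the conjugates T^-i A_j T^i with 0 < i < k_j, and
   f_s (T^-i A_j T^i) = \sum_r 'C(r, s) i^(r - s) f_r (A_j). Faulhaber's formula
   for \sum_(0 < i < k_j) i^(r - s) has a term k_j^(r - s + 1) / (r - s + 1), a
   constant term beta_(r - s), and terms that recombine, by Taylor expansion at
   k_j, into values of f_t at T^-k_j A_j T^k_j. Conjugation by S turns the
   latter into values of f_(t^* ) at A_(j + 1); summing over the cycle of the
   A_j, the index j + 1 may be replaced by j. *)

(** * Bernoulli numbers by umbral calculus *)

(** Coefficient of t^(n+1) in the generating identity, scaled by (n+1)!; the top term drops out
    because e^t - 1 has no constant term. *)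
Lemma bernoulli_rec n :
  \sum_(i < n.+1) 'C(n.+1, i)%:R * bernoulli i = (n == 0%N)%:R.
Proof.
have := bernoulli_egf n.+1.
rewrite /fps_mul big_ord_recr /= subnn fact0 invr1 subrr mulr0 addr0 eqSS => H.
transitivity ((n.+1)`!%:R * (n == 0%N)%:R : rat); last first.
  by case: (n) => [|n'] /=; rewrite ?mulr0 ?mulr1.
rewrite -H big_distrr /=; apply: eq_bigr => i _.
have le_in : (i <= n)%N by rewrite -ltnS.
rewrite subSn //= subr0 -subSn // -(@bin_fact n.+1 i) ?leqW // !natrM.
have nz k : k`!%:R != 0 :> rat by rewrite pnatr_eq0 -lt0n fact_gt0.
by field; rewrite !nz.
Qed.

(** The functional X^i |-> B_i, which sends (X + c)^n to the value B_n(c) of the Bernoulli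
    polynomial. *)
Definition umbral (p : {poly rat}) : rat :=
  \sum_(i < size p) p`_i * bernoulli i.

Lemma umbral_widen (N : nat) (p : {poly rat}) : (size p <= N)%N ->
  umbral p = \sum_(i < N) p`_i * bernoulli i.
Proof.
move=> le_pN; rewrite /umbral.
rewrite (big_ord_widen _ (fun i => p`_i * bernoulli i) le_pN).
rewrite big_mkcond /=; apply: eq_bigr => i _; case: ltnP => // le_pi.
by rewrite nth_default ?mul0r.
Qed.

Lemma umbral_is_scalar : scalar umbral.
Proof.
move=> c p q; set N := maxn (size p) (size q).
have lepN : (size p <= N)%N by rewrite leq_maxl.
have leqN : (size q <= N)%N by rewrite leq_maxr.
rewrite (umbral_widen lepN) (umbral_widen leqN) (@umbral_widen N).
  rewrite big_distrr -big_split /=; apply: eq_bigr => i _.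
  by rewrite coefD coefZ mulrDl -mulrA.
rewrite (leq_trans (size_polyD _ _)) // geq_max leqN.
by rewrite (leq_trans (size_scale_leq _ _)).
Qed.

HB.instance Definition _ :=
  GRing.isLinear.Build rat {poly rat} rat *%R umbral umbral_is_scalar.

Lemma umbralXn n : umbral 'X^n = bernoulli n.
Proof.
rewrite (@umbral_widen n.+1) ?size_polyXn // big_ord_recr /=.
rewrite coefXn eqxx mul1r big1 ?add0r // => i _.
by rewrite coefXn ltn_eqF ?mul0r.
Qed.

Lemma umbral_shiftXn n : umbral (('X + 1) ^+ n) = bernoulli n + (n == 1%N)%:R.
Proof.
rewrite addrC exprDn raddf_sum /=.
under eq_bigr => i _ do rewrite expr1n mul1r raddfMn /= umbralXn -mulr_natl.
rewrite big_ord_recr /= binn mul1r addrC; congr (_ + _).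
by case: n => [|n]; rewrite ?big_ord0 // bernoulli_rec.
Qed.

(** Linear extension of B_n(1) - B_n(0) = [n = 1] from the monomials. *)
Lemma umbral_shift p : umbral (p \Po ('X + 1)) = umbral p + p`_1.
Proof.
rewrite comp_polyE -[in RHS](coefK p) poly_def coef_sum !raddf_sum /=.
rewrite -big_split; apply: eq_bigr => i _ /=.
by rewrite !linearZ /= umbral_shiftXn umbralXn coefZ coefXn eq_sym -mulrDr.
Qed.

(* Both [L : p |-> umbral p] and [L : p |-> umbral (p \Po (- 1 - 'X))] satisfy
   [L (p \Po ('X + 1)) = L p + p`_1], which determines a linear functional. *)
Lemma umbral_reflect n : umbral ((- 1 - 'X) ^+ n) = bernoulli n.
Proof.
(* A let-bound Y would be unfolded by exprDn. *)
have [Y defY] : {Y : {poly rat} | Y = - 1 - 'X} by exists (- 1 - 'X).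
rewrite -defY; have [k] := ubnP n; elim: k n => // k IHk n /ltnSE le_nk.
(* With -X = 1 + Y, the exponent n + 1 makes Y^(n+1) cancel between the two sides; in what is left
   Y^n has the nonzero coefficient n + 1, and the lower powers are known by induction. *)
have := umbral_shift ((- 'X) ^+ n.+1).
rewrite rmorphXn rmorphN /= comp_polyX opprD [- 'X - 1]addrC -defY.
rewrite -[- 'X in X in _ = _ + X]scaleN1r exprZn coefZ coefXn.
have -> : - 'X = 1 + Y by rewrite defY addrA subrr add0r.
rewrite exprDn raddf_sum big_ord_recr /= subnn expr0 mul1r binn mulr1n.
rewrite addrAC -{1}[umbral (Y ^+ _)]add0r => /addIr/esym.
under eq_bigr => i _ do rewrite expr1n mul1r raddfMn /= -mulr_natl.
have -> : (-1) ^+ n.+1 * (1%N == n.+1)%:R = - (n == 0%N)%:R :> rat.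
  by case: (n) => [|n'] /=; rewrite ?mulr0 ?oppr0 // expr1 mulr1.
move/subr0_eq; rewrite -(bernoulli_rec n) !big_ord_recr /=.
under eq_bigr => i _ do rewrite IHk ?(leq_trans (ltn_ord i)) //.
by move/addrI/mulfI; apply; rewrite pnatr_eq0 binSn.
Qed.

(** Compares shift and reflection through -1 - X = -(X + 1). This gives at once B_1 = -1/2 and B_n =
    0 for odd n >= 3. *)
Lemma bernoulli_sign n :
  (-1) ^+ n * (bernoulli n + (n == 1%N)%:R) = bernoulli n.
Proof.
rewrite -umbral_shiftXn -[RHS]umbral_reflect -linearZ /=; congr umbral.
have -> : - 1 - 'X = (- 1) *: ('X + 1) :> {poly rat}.
  by rewrite scaleN1r opprD addrC.
by rewrite exprZn.
Qed.

(** * Power sums *)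

Lemma coef_exp_XaddC (R : comNzRingType) (c : R) q s :
  (('X + c%:P) ^+ q)`_s = 'C(q, s)%:R * c ^+ (q - s).
Proof.
rewrite addrC exprDn coef_sum.
under eq_bigr => i _ do rewrite -polyC_exp coefMn coefCM coefXn.
have [le_sq|lt_qs] := leqP s q.
  rewrite (bigD1 (inord s)) //= inordK // eqxx mulr1 big1 ?addr0 ?mulr_natl //.
  move=> i ne_is; rewrite -(inj_eq val_inj) /= inordK // eq_sym in ne_is.
  by rewrite (negPf ne_is) mulr0 mul0rn.
rewrite bin_small // mul0r big1 // => i _.
by rewrite gtn_eqF ?mulr0 ?mul0rn // (leq_trans (ltn_ord i)).
Qed.

(** Telescoping in k: the increment given by [umbral_shift] at (X + k)^(p+1) is its coefficient of
    X, namely (p+1) k^p. *)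
Lemma umbral_faulhaber p k :
  \sum_(i < k) (i%:R : rat) ^+ p * p.+1%:R =
  umbral (('X + k%:R%:P) ^+ p.+1) - bernoulli p.+1.
Proof.
rewrite -umbralXn -[in X in _ - X](addr0 'X) -polyC0.
elim: k => [|k IHk]; first by rewrite big_ord0 subrr.
rewrite big_ord_recr /= IHk addrAC; congr (_ - _).
have := umbral_shift (('X + k%:R%:P) ^+ p.+1).
rewrite coef_exp_XaddC bin1 subn1 /= mulrC => <-.
rewrite rmorphXn rmorphD /= comp_polyX comp_polyC -addrA.
by congr (umbral ((_ + _) ^+ _)); rewrite -natr1 polyCD addrC.
Qed.

Definition beta' i : rat := (-1) ^+ i * beta i.

Lemma beta'E i : beta' i = bernoulli i.+1 / i.+1%:R.
Proof. by rewrite /beta' /beta !mulrA -expr2 sqrr_sign mul1r. Qed.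

Lemma bernoulli0 : bernoulli 0 = 1.
Proof. by have := bernoulli_rec 0; rewrite big_ord1 bin0 mul1r. Qed.

(** Bernoulli numbers of odd index vanish beyond B_1, so the two terms are opposite except at p = 0,
    where the sum is 2 B_1. *)
Lemma beta_beta' p : beta p + beta' p = - (p == 0%N)%:R.
Proof.
rewrite beta'E /beta -mulrDl -[in X in _ + X]bernoulli_sign exprS eqSS.
by case: p => [|p]; rewrite ?divr1 /=; ring.
Qed.

(** Faulhaber's formula, with C(p+1, i+1) / (p+1) = C(p, i) / (i+1) absorbed into [beta']. The term
    i = p of the sum is the constant [beta' p]; together with [beta p] it only corrects for the
    omitted 0^p. *)
Lemma sum_pow_beta p k : (0 < k)%N ->
  \sum_(1 <= i < k) (i%:R : rat) ^+ p =
  k%:R ^+ p.+1 / p.+1%:R + beta p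
  + \sum_(i < p.+1) 'C(p, i)%:R * beta' i * k%:R ^+ (p - i).
Proof.
move=> k_gt0; have nz : p.+1%:R != 0 :> rat by rewrite pnatr_eq0.
apply: (mulIf nz).
have -> : \sum_(1 <= i < k) (i%:R : rat) ^+ p =
    \sum_(i < k) i%:R ^+ p - (p == 0%N)%:R.
  rewrite -(big_mkord xpredT (fun i => (i%:R : rat) ^+ p)) big_ltn //.
  by rewrite addrAC; case: (p) => [|p']; rewrite ?expr0 ?expr0n /= subrr add0r.
rewrite mulrBl big_distrl /= umbral_faulhaber exprDn raddf_sum big_ord_recl /=.
rewrite subn0 expr0 mulr1 bin0 mulr1n umbralXn [bernoulli _ + _]addrC addrK.
rewrite -mulNr -beta_beta'.
under eq_bigr => i _ do
  rewrite -polyC_exp mulrC mul_polyC raddfMn /= linearZ /= umbralXn.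
(* Reversal orders the [beta'] sum by powers of k, as in the binomial expansion; its constant term
   [beta' p] and the leading k^(p+1) are split off. *)
rewrite big_ord_recr /= [in RHS](reindex_inj rev_ord_inj) big_ord_recl /=.
rewrite !subn1 /= subnn expr0 mulr1 !binn mul1r /bump add1n subnn.
rewrite bernoulli0 mulr1 mulr1n.
set s1 := \sum_(i < p) _; set s2 := \sum_(i < p) _.
suff -> : s1 = s2 * p.+1%:R by field; rewrite nat1r.
rewrite {}/s1 {}/s2 big_distrl /=; apply: eq_bigr => i _; rewrite add1n !subSS.
have lt_ip := ltn_ord i; rewrite bin_sub // subKn //.
have -> : (p - i = (p - i.+1).+1)%N by rewrite subnSK.
have nz_d : (p - i.+1).+1%:R != 0 :> rat by rewrite pnatr_eq0.
have E : 'C(p.+1, i.+1)%:R = p.+1%:R * 'C(p, i.+1)%:R / (p - i.+1).+1%:R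
    :> rat.
  by rewrite -natrM (mul_bin_down p.+1) subSS -subnSK // natrM mulrC mulKf.
rewrite -[_ *+ 'C(_, _)]mulr_natr {}E beta'E.
by field; rewrite nat1r.
Qed.

(** * Sums of Taylor coefficients over integer shifts *)

Lemma coef_comp_XaddC (R : comNzRingType) (p : {poly R}) (c : R) s D :
  (size p <= D)%N ->
  (p \Po ('X + c%:P))`_s = \sum_(r < D) p`_r * ('C(r, s)%:R * c ^+ (r - s)).
Proof.
move=> le_pD; rewrite coef_comp_poly.
under eq_bigr => i _ do rewrite coef_exp_XaddC.
rewrite (big_ord_widen _ (fun r => p`_r * ('C(r, s)%:R * c ^+ (r - s))) le_pD).
rewrite big_mkcond /=; apply: eq_bigr => i _; case: ltnP => // le_pi.
by rewrite nth_default ?mul0r.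
Qed.

(** Trinomial revision: both sides are r! / (s! (t-s)! (r-t)!). *)
Lemma mul_binA r t s : (s <= t <= r)%N ->
  ('C(r, t) * 'C(t, s) = 'C(r, s) * 'C(r - s, t - s))%N.
Proof.
case/andP=> le_st le_tr; have le_sr := leq_trans le_st le_tr.
apply/eqP; rewrite -(@eqn_pmul2r (s`! * (t - s)`! * (r - t)`!)); last first.
  by rewrite !muln_gt0 !fact_gt0.
apply/eqP; transitivity r`!.
  by rewrite -(bin_fact le_tr) -(bin_fact le_st); ring.
have le_ts : (t - s <= r - s)%N by rewrite leq_sub2r.
rewrite -(bin_fact le_sr) -(bin_fact le_ts).
have -> : (r - s - (t - s) = r - t)%N by lia.
by ring.
Qed.

(** Put t = s + i and use [mul_binA]; outside s <= t <= r a binomial vanishes. The range of t no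
    longer depends on r, so sums over r and t can be exchanged and the last factor summed to a
    Taylor coefficient at x. *)
Lemma sum_bin_shift (c : nat -> rat) (x : rat) D r s : (r < D)%N ->
  'C(r, s)%:R * (\sum_(i < (r - s).+1) 'C(r - s, i)%:R * c i * x ^+ (r - s - i))
  = \sum_(t < D) 'C(t, s)%:R * c (t - s)%N * ('C(r, t)%:R * x ^+ (r - t)).
Proof.
move=> lt_rD; have [lt_rs|le_sr] := ltnP r s.
  rewrite bin_small // mul0r big1 // => t _.
  have [lt_ts|le_st] := ltnP t s; first by rewrite bin_small // !mul0r.
  by rewrite ['C(r, t)]bin_small ?(leq_trans lt_rs) // mul0r mulr0.
rewrite -(big_mkord xpredT (fun t =>
  'C(t, s)%:R * c (t - s)%N * ('C(r, t)%:R * x ^+ (r - t)))).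
rewrite (big_cat_nat (n := r.+1)) //= addrC.
rewrite [X in _ = X + _]big1_seq ?add0r; last first.
  move=> t /=; rewrite mem_index_iota => /andP[lt_rt _].
  by rewrite ['C(r, t)]bin_small // mul0r mulr0.
rewrite (big_cat_nat (n := s)) //= ?(leqW le_sr) //.
rewrite [X in _ = X + _]big1_seq ?add0r; last first.
  move=> t /=; rewrite mem_index_iota => /andP[_ lt_ts].
  by rewrite bin_small // !mul0r.
rewrite -[X in \sum_(X <= _ < _) _]add0n big_addn subSn //.
rewrite big_mkord big_distrr /=.
apply: eq_bigr => i _; have le_i := ltn_ord i.
rewrite addnK -subnDA [(s + i)%N]addnC !mulrA -!natrM.
have := @mul_binA r (i + s) s; rewrite addnK => <-; last by lia.
by rewrite natrM; ring.
Qed.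

(** Taylor expansion at i, then [sum_pow_beta] with exponent r - s in each degree r; [sum_bin_shift]
    regroups the [beta'] part into Taylor coefficients at k. *)
Lemma sum_coef_shift (p : {poly rat}) D s k :
  (size p <= D)%N -> (0 < k)%N ->
  \sum_(1 <= i < k) (p \Po ('X + i%:R%:P))`_s =
  \sum_(r < D) 'C(r, s)%:R *
    (beta (r - s) + k%:R ^+ (r - s).+1 / (r - s).+1%:R) * p`_r
  + \sum_(t < D) 'C(t, s)%:R * beta' (t - s) * (p \Po ('X + k%:R%:P))`_t.
Proof.
move=> le_pD k_gt0.
under eq_bigr => i _ do rewrite (coef_comp_XaddC _ _ le_pD).
under [X in _ = _ + X]eq_bigr => t _ do
  rewrite (coef_comp_XaddC _ _ le_pD) big_distrr /=.
rewrite exchange_big /= [X in _ = _ + X]exchange_big -big_split /=.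
apply: eq_bigr => r _.
under [X in _ = _ + X]eq_bigr => t _ do rewrite mulrCA.
rewrite -!big_distrr /= -(sum_bin_shift beta' k%:R s (ltn_ord r)).
by rewrite sum_pow_beta //; ring.
Qed.

(** * Quadratic forms under conjugation by T and S *)

Lemma size_exp_le3 (R : comNzRingType) (p : {poly R}) N :
  (size p <= 3)%N -> (size (p ^+ N) <= (2 * N).+1)%N.
Proof.
move=> le_p3; rewrite (leq_trans (size_poly_exp_leq _ _)) // ltnS leq_mul2r.
by apply/orP; right; case: (size p) le_p3.
Qed.

Definition form (B : 'M[int]_2) : {poly int} :=
  (B 1 0)%:P * 'X^2 + (B 1 1 - B 0 0)%:P * 'X - (B 0 1)%:P.

Lemma fE n r B : f n r B = (form B ^+ (n - 1))`_r.
Proof. by []. Qed.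

Lemma size_form B : (size (form B) <= 3)%N.
Proof.
apply/leq_sizeP => j le3j; rewrite /form !coefE.
by case: j le3j => [|[|[|j]]] //= _; rewrite !mulr0 addr0 subr0.
Qed.

Lemma mx22_eta (B : 'M[int]_2) : B = mx22 (B 0 0) (B 0 1) (B 1 0) (B 1 1).
Proof.
apply/matrixP => i j; rewrite !mxE.
by case: i => -[|[|[]]] // ?; case: j => -[|[|[]]] // ? /=;
  congr (B _ _); apply: val_inj.
Qed.

Lemma form_mx22 a b c d :
  form (mx22 a b c d) = c%:P * 'X^2 + (d - a)%:P * 'X - b%:P.
Proof. by rewrite /form !mxE. Qed.

Lemma mx22_1 : mx22 1 0 0 1 = 1.
Proof.
apply/matrixP => i j; rewrite !mxE.
by case: i => -[|[|[]]] // ?; case: j => -[|[|[]]] // ?.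
Qed.

Lemma invTm : Tm^-1 = mx22 1 (-1) 0 1.
Proof.
by apply: (mulrI Tm_unit); rewrite mulrV ?Tm_unit // /Tm mx22_mul -mx22_1.
Qed.

Lemma Sm_unit : Sm \is a GRing.unit.
Proof.
by apply/unitrP; exists (mx22 0 1 (-1) 0); rewrite /Sm !mx22_mul -mx22_1.
Qed.

Lemma invSm : Sm^-1 = mx22 0 1 (-1) 0.
Proof.
by apply: (mulrI Sm_unit); rewrite mulrV ?Sm_unit // /Sm mx22_mul -mx22_1.
Qed.

Lemma Vm_unit : Vm \is a GRing.unit.
Proof.
by apply/unitrP; exists (mx22 1 0 (-1) 1); rewrite /Vm !mx22_mul -mx22_1.
Qed.

Lemma form_conjT B : form (Tm^-1 * B * Tm) = form B \Po ('X + 1).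
Proof.
rewrite invTm [in LHS](mx22_eta B) /Tm !mx22_mul form_mx22 /form.
rewrite comp_polyB comp_polyD !comp_polyM !comp_polyC comp_polyX.
rewrite !(polyCD, polyCN, polyCM, polyC1, polyC0); ring.
Qed.

Lemma form_conjS B : form (Sm^-1 * B * Sm) =
  (- B 0 1)%:P * 'X^2 - (B 1 1 - B 0 0)%:P * 'X + (B 1 0)%:P.
Proof.
rewrite invSm [in LHS](mx22_eta B) /Sm !mx22_mul form_mx22.
rewrite !(polyCD, polyCN, polyCM, polyC1, polyC0); ring.
Qed.

Lemma form_conjTX B k :
  form (Tm ^- k * B * Tm ^+ k) = form B \Po ('X + k%:R%:P).
Proof.
elim: k => [|k IHk].
  by rewrite !expr0 invr1 mul1r mulr1 addr0 comp_polyXr.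
have -> : Tm ^- k.+1 * B * Tm ^+ k.+1 = Tm^-1 * (Tm ^- k * B * Tm ^+ k) * Tm.
  by rewrite exprSr invrM ?unitrX ?Tm_unit // !mulrA.
rewrite form_conjT IHk -comp_polyA.
rewrite [('X + _) \Po _]comp_polyD comp_polyX comp_polyC.
by rewrite -natr1 polyCD polyC1; congr (_ \Po _); ring.
Qed.

(* X^D p(-1/X), when p has degree at most D. *)
Definition inv_rev (R : comNzRingType) D (p : {poly R}) : {poly R} :=
  \poly_(i < D.+1) ((-1) ^+ i * p`_(D - i)).

Lemma inv_revD (R : comNzRingType) D (p q : {poly R}) :
  inv_rev D (p + q) = inv_rev D p + inv_rev D q.
Proof.
by apply/polyP => i; rewrite !coefE; case: ifP; rewrite ?addr0 // mulrDr.
Qed.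

Lemma inv_revCM (R : comNzRingType) D (c : R) (p : {poly R}) :
  inv_rev D (c%:P * p) = c%:P * inv_rev D p.
Proof.
by apply/polyP => i; rewrite !coefE; case: ifP; rewrite ?mulr0 // mulrCA.
Qed.

(** For D of either parity, [inv_rev D p] is (-X)^D p(-1/X): the extra -X cancels against the -1/X
    coming from X. *)
Lemma inv_revS_mulX (R : comNzRingType) D (p : {poly R}) :
  inv_rev D.+1 ('X * p) = inv_rev D p.
Proof.
apply/polyP => i; rewrite !coefE !ltnS; have [le_iD|lt_Di] := leqP i D.
  by rewrite leqW // subSn.
by rewrite subn_eq0 lt_Di mulr0 if_same.
Qed.

Lemma inv_revS (R : comNzRingType) D (p : {poly R}) : (size p <= D.+1)%N ->
  inv_rev D.+1 p = - 'X * inv_rev D p.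
Proof.
move=> le_pD; apply/polyP => -[|i]; rewrite mulNr !coefE /=.
  by rewrite subn0 nth_default ?mulr0 ?oppr0.
by rewrite subSS ltnS; case: ifP; rewrite ?oppr0 // exprS !mulN1r mulNr.
Qed.

(** The substitution z |-> -1/z. Each induction step raises the degree bound by two: X^2 absorbs
    both factors -X, X absorbs one, the constant term none, which gives c X^2 - b X + a. *)
Lemma inv_rev_quadratic_exp (R : comNzRingType) (a b c : R) N :
  ((c%:P * 'X^2 - b%:P * 'X + a%:P) ^+ N) =
  inv_rev (2 * N) ((a%:P * 'X^2 + b%:P * 'X + c%:P) ^+ N).
Proof.
elim: N => [|N IHN].
  by rewrite /inv_rev !expr0; apply/polyP => -[|i]; rewrite !coefE // mul1r.
set q := a%:P * _ + _ + _; rewrite mulnS !add2n exprS [in RHS]exprS.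
have le_q3 : (size q <= 3)%N.
  apply/leq_sizeP => j le3j; rewrite /q !coefE.
  by case: j le3j => [|[|[|j]]] //= _; rewrite !mulr0 !addr0.
have le_qN := size_exp_le3 N le_q3.
have -> : q * q ^+ N =
    a%:P * ('X * ('X * q ^+ N)) + b%:P * ('X * q ^+ N) + c%:P * q ^+ N.
  by rewrite {1}/q; ring.
rewrite !inv_revD !inv_revCM !inv_revS_mulX !inv_revS ?(leqW le_qN) // -/q IHN.
ring.
Qed.

Lemma f_conjS n r B : (r <= 2 * n - 2)%N ->
  f n r (Sm^-1 * B * Sm) = (-1) ^+ r * f n (star n r) B.
Proof.
move=> le_r; rewrite !fE form_conjS.
rewrite inv_rev_quadratic_exp polyCN -/(form B).
by rewrite /inv_rev coef_poly /star mulnBr muln1 ltnS le_r.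
Qed.

Definition form_exp n B : {poly rat} := map_poly intr (form B ^+ (n - 1)).

Lemma form_expE n B r : (form_exp n B)`_r = (f n r B)%:~R.
Proof. by rewrite coef_map fE. Qed.

Lemma size_form_exp n B : (size (form_exp n B) <= (2 * n - 2).+1)%N.
Proof.
rewrite (leq_trans (size_poly _ _)) //.
by rewrite (leq_trans (size_exp_le3 _ (size_form B))) // mulnBr.
Qed.

Lemma form_exp_conjTX n B k :
  form_exp n (Tm ^- k * B * Tm ^+ k) = form_exp n B \Po ('X + k%:R%:P).
Proof.
rewrite /form_exp form_conjTX -[_ ^+ (n - 1)](rmorphXn (comp_poly _)) /=.
rewrite map_comp_poly.
by rewrite rmorphD /= map_polyX map_polyC /= rmorph_nat.
Qed.

(** * The contribution of one factor T^k S *)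

(** The [beta'] sum of [sum_coef_shift], read backwards through t = [star n r], becomes by [f_conjS]
    a sum over the conjugate by T^k S, the next matrix of the cycle. *)
Lemma sum_f_block n s k B : (s <= 2 * n - 2)%N -> (0 < k)%N ->
  \sum_(1 <= i < k) (f n s (Tm ^- i * B * Tm ^+ i))%:~R =
  \sum_(r < (2 * n - 2).+1) 'C(r, s)%:R *
    (beta (r - s) + k%:R ^+ (r - s).+1 / (r - s).+1%:R) * (f n r B)%:~R
  + (-1) ^+ s * \sum_(r < (2 * n - 2).+1)
      'C(star n r, s)%:R * beta (star n r - s) *
      (f n r ((Tm ^+ k * Sm)^-1 * B * (Tm ^+ k * Sm)))%:~R.
Proof.
move=> le_s k_gt0.
under eq_bigr => i _ do rewrite -form_expE form_exp_conjTX.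
rewrite (sum_coef_shift s (size_form_exp n B) k_gt0).
congr (_ + _); first by apply: eq_bigr => r _; rewrite form_expE.
rewrite [LHS](reindex_inj rev_ord_inj) big_distrr /=; apply: eq_bigr => r _.
rewrite subSS -/(star n r) -form_exp_conjTX form_expE.
have -> : (Tm ^+ k * Sm)^-1 * B * (Tm ^+ k * Sm) =
    Sm^-1 * (Tm ^- k * B * Tm ^+ k) * Sm.
  by rewrite invrM ?unitrX ?Tm_unit ?Sm_unit // !mulrA.
have le_r : (r <= 2 * n - 2)%N by rewrite -ltnS.
rewrite f_conjS // /beta'.
(* When the subtraction truncates, the binomial is 0. When it is exact, r + [star n r] being even
   leaves the sign (-1)^s. *)
have [lt_rs|le_sr] := ltnP (star n r) s.
  by rewrite bin_small // !mul0r mulr0.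
have -> : (-1) ^+ (star n r - s) = (-1) ^+ s * (-1) ^+ r :> rat.
  have : odd (star n r - s + s + r) = false.
    by rewrite subnK // /star subnK // -[X in (_ - X)%N]muln1 -mulnBr oddM.
  rewrite -signr_odd -[(-1) ^+ s]signr_odd -[(-1) ^+ r]signr_odd -signr_addb.
  by rewrite !oddD; do 3!case: odd.
rewrite rmorphM rmorph_sign; ring.
Qed.

(** * Conjugates along a word *)

(** [conj_iter] unfolds at the last letter used, whereas induction on the word removes the first. *)
Lemma conj_iterS X Xs A i :
  conj_iter (X :: Xs) A i.+1 = conj_iter Xs (X^-1 * A * X) i.
Proof. by elim: i => //= i ->. Qed.

Lemma conj_iter_prod Xs A : all [in GRing.unit] Xs ->
  conj_iter Xs A (size Xs) = (\prod_(X <- Xs) X)^-1 * A * \prod_(X <- Xs) X.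
Proof.
elim: Xs A => [|X Xs IHXs] A; first by rewrite big_nil invr1 mul1r mulr1.
case/andP=> X_unit Xs_unit; rewrite [size _]/= conj_iterS IHXs // big_cons.
have prod_unit : \prod_(Y <- Xs) Y \is a GRing.unit.
  by rewrite big_seq rpred_prod //; apply/allP.
by rewrite invrM // !mulrA.
Qed.

Lemma sum_conj_iter_cons (V : nmodType) (g : 'M[int]_2 -> V) X Xs A :
  \sum_(i < size (X :: Xs)) g (conj_iter (X :: Xs) A i) =
  g A + \sum_(i < size Xs) g (conj_iter Xs (X^-1 * A * X) i).
Proof.
rewrite big_ord_recl; congr (_ + _).
by apply: eq_bigr => i _; rewrite conj_iterS.
Qed.

Lemma conjTX_S i B :
  Tm ^- i * (Tm^-1 * B * Tm) * Tm ^+ i = Tm ^- i.+1 * B * Tm ^+ i.+1.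
Proof. by rewrite exprS invrM ?unitrX ?Tm_unit // !mulrA. Qed.

(** Each letter contributes the matrix before its own conjugation, so T^l V yields the exponents 0
    to l, the last one at V. *)
Lemma sum_conj_iter_block (V : nmodType) (g : 'M[int]_2 -> V) l Xs A :
  \sum_(i < size (rcons (nseq l Tm) Vm ++ Xs))
    g (conj_iter (rcons (nseq l Tm) Vm ++ Xs) A i) =
  \sum_(0 <= i < l.+1) g (Tm ^- i * A * Tm ^+ i)
  + \sum_(i < size Xs)
      g (conj_iter Xs (Vm^-1 * (Tm ^- l * A * Tm ^+ l) * Vm) i).
Proof.
elim: l A => [|l IHl] A.
  by rewrite sum_conj_iter_cons big_nat1 /= expr0 invr1 mul1r mulr1.
rewrite [rcons _ _ ++ _]/= sum_conj_iter_cons IHl addrA.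
rewrite [in RHS]big_nat_recl // expr0 invr1 mul1r mulr1.
by rewrite conjTX_S; congr (_ + _ + _); apply: eq_bigr => i _; rewrite conjTX_S.
Qed.

(** Starting from T^-1 A T shifts the exponents 0 to k - 2 of a block by one. *)
Lemma sum_TV_word (V : nmodType) (g : 'M[int]_2 -> V) ks A : all (leq 2) ks ->
  \sum_(i < size (TV_word ks)) g (conj_iter (TV_word ks) (Tm^-1 * A * Tm) i) =
  \sum_(j < size ks) \sum_(1 <= i < nth 0%N ks j)
    g (Tm ^- i * conj_iter (TS_factors ks) A j * Tm ^+ i).
Proof.
elim: ks A => [|k ks IHks] A; first by rewrite !big_ord0.
case/andP=> k_ge2 ks_ge2.
rewrite -[TV_word (k :: ks)]/(rcons (nseq (k - 2) Tm) Vm ++ TV_word ks).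
rewrite sum_conj_iter_block big_ord_recl.
congr (_ + _).
  rewrite big_add1; have -> : (k - 2).+1 = k.-1 by lia.
  by apply: eq_bigr => i _; rewrite conjTX_S.
set X := Tm ^+ k * Sm.
have -> : Vm^-1 * (Tm ^- (k - 2) * (Tm^-1 * A * Tm) * Tm ^+ (k - 2)) * Vm =
    Tm^-1 * (X^-1 * A * X) * Tm.
  have X_unit : X \is a GRing.unit by rewrite rpredM ?unitrX ?Tm_unit ?Sm_unit.
  (* Since V = T S T, the block preceded by the initial T is T^k S T: the next block again starts
     from a conjugate by T, now of the next A_j. *)
  have defX : Tm ^+ (k - 2).+1 * Vm = X * Tm.
    have -> : Vm = Tm * Sm * Tm by rewrite /Tm /Sm !mx22_mul.
    by rewrite !mulrA -exprSr; have -> : (k - 2).+2 = k by lia.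
  transitivity ((X * Tm)^-1 * A * (X * Tm)); last first.
    by rewrite invrM ?Tm_unit // !mulrA.
  by rewrite -defX conjTX_S invrM ?unitrX ?Tm_unit ?Vm_unit // !mulrA.
rewrite IHks //; apply: eq_bigr => j _.
by rewrite lift0 -[TS_factors (k :: ks)]/(X :: TS_factors ks) conj_iterS.
Qed.

Lemma nth_TS_factors ks j : (j < size ks)%N ->
  (TS_factors ks)`_j = Tm ^+ nth 0%N ks j * Sm.
Proof. by move=> lt_j; rewrite (nth_map 0%N). Qed.

(** The difference telescopes to the values of [g] at the two ends of a closed cycle. *)
Lemma sum_conj_iter_rot (V : zmodType) (g : 'M[int]_2 -> V) Xs A :
  conj_iter Xs A (size Xs) = A ->
  \sum_(j < size Xs) g (conj_iter Xs A j.+1) =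
  \sum_(j < size Xs) g (conj_iter Xs A j).
Proof.
move=> cycA; apply/eqP; rewrite -subr_eq0 -sumrB.
rewrite -(big_mkord xpredT
  (fun j => g (conj_iter Xs A j.+1) - g (conj_iter Xs A j))).
by rewrite (telescope_sumr (fun j => g (conj_iter Xs A j))) // cycA subrr.
Qed.

(** * Summation over the whole cycle *)

Lemma sum_f_word n s ks A : (s <= 2 * n - 2)%N -> all (leq 2) ks ->
  A = \prod_(k <- ks) (Tm ^+ k * Sm) ->
  \sum_(i < size (TV_word ks))
    (f n s (conj_iter (TV_word ks) (Tm^-1 * A * Tm) i))%:~R =
  \sum_(j < size ks) \sum_(r < (2 * n - 2).+1)
    ('C(r, s)%:R * (beta (r - s)
       + (nth 0%N ks j)%:R ^+ (r - s).+1 / (r - s).+1%:R)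
     + (-1) ^+ s * 'C(star n r, s)%:R * beta (star n r - s)) *
    (f n r (conj_iter (TS_factors ks) A j))%:~R.
Proof.
move=> le_s ks_ge2 defA.
rewrite (sum_TV_word (fun B => (f n s B)%:~R)) //.
(* The part of [sum_f_block] carried by the next matrix. Its coefficients do not involve k_j, so
   rotating the cycle moves it back to A_j. *)
pose h B : rat := \sum_(r < (2 * n - 2).+1)
  'C(star n r, s)%:R * beta (star n r - s) * (f n r B)%:~R.
(* The cycle closes because A is the product of the factors and commutes with itself. *)
have cycA : conj_iter (TS_factors ks) A (size (TS_factors ks)) = A.
  have unitTS : all [in GRing.unit] (TS_factors ks).
    apply/allP => _ /mapP[k _ ->].
    by rewrite /= rpredM ?unitrX ?Tm_unit ?Sm_unit.
  rewrite conj_iter_prod // big_map -defA mulVr ?mul1r // defA.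
  rewrite -(big_map _ xpredT id) big_seq rpred_prod //; exact/allP.
have := sum_conj_iter_rot h cycA; rewrite size_map => rot_h.
transitivity (\sum_(j < size ks) (\sum_(r < (2 * n - 2).+1) 'C(r, s)%:R *
    (beta (r - s) + (nth 0%N ks j)%:R ^+ (r - s).+1 / (r - s).+1%:R) *
    (f n r (conj_iter (TS_factors ks) A j))%:~R)
  + (-1) ^+ s * \sum_(j < size ks) h (conj_iter (TS_factors ks) A j.+1)).
  rewrite big_distrr -big_split; apply: eq_bigr => j _.
  have k_ge2 := allP ks_ge2 _ (mem_nth 0%N (ltn_ord j)).
  by rewrite (sum_f_block _ le_s) ?(ltnW k_ge2) // /= nth_TS_factors.
rewrite rot_h big_distrr -big_split; apply: eq_bigr => j _ /=.
rewrite big_distrr -big_split; apply: eq_bigr => r _ /=.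
ring.
Qed.

Lemma odd_star n m : (m <= 2 * n - 2)%N -> odd (star n m) = odd m.
Proof. by move=> le_m; rewrite /star; lia. Qed.

Theorem theorem6p2 (n m : nat) (A : 'M[int]_2) (ks : seq nat)
  (hn : (2 <= n)%N) (hm : (m <= 2 * n - 2)%N)
  (hdet : \det A = 1) (hhyp : hyperbolic A)
  (hks : all (leq 2) ks)
  (hA : A = \prod_(k <- ks) (Tm ^+ k * Sm)) :
  Psi n m A (TV_word ks) =
  (u A)%:~R ^ (1 - n%:Z) *
  \sum_(j < size ks) \sum_(r < (2 * n - 2).+1)
    ( 'C(r, star n m)%:R * beta (r - star n m)%N
    - 'C(star n r, m)%:R * beta (star n r - m)%N
    - (-1) ^+ m * 'C(r, m)%:R * beta (r - m)%N
    + (-1) ^+ m * 'C(star n r, star n m)%:R * beta (star n r - star n m)%N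
    - (-1) ^+ m * 'C(r, m)%:R
        * ((nth 0%N ks j)%:R ^+ (r - m)%N.+1 / (r - m)%N.+1%:R)
    + 'C(r, star n m)%:R
        * ((nth 0%N ks j)%:R ^+ (r - star n m)%N.+1 / (r - star n m)%N.+1%:R) )
    * (f n r (conj_iter (TS_factors ks) A j))%:~R.
Proof.
rewrite /Psi; congr (_ * _).
have le_m' : (star n m <= 2 * n - 2)%N by rewrite leq_subr.
under eq_bigr => i _ do rewrite rmorphB rmorphM rmorph_sign.
rewrite sumrB -big_distrr /= (sum_f_word hm hks hA) (sum_f_word le_m' hks hA).
rewrite big_distrr -sumrB; apply: eq_bigr => j _ /=.
rewrite big_distrr -sumrB; apply: eq_bigr => r _ /=.
(* By equal parity the sum for [star n m] also carries (-1)^m. In the sum for m this sign meets the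
   outer (-1)^m and cancels, leaving the term in 'C(star n r, m) without a power of -1. *)
rewrite -[(-1) ^+ star n m]signr_odd odd_star // signr_odd.
have sq : (-1) ^+ m * (-1) ^+ m = 1 :> rat by rewrite -expr2 sqrr_sign.
have signE (a b c F : rat) :
  (-1) ^+ m * ((a + (-1) ^+ m * b * c) * F) = ((-1) ^+ m * a + b * c) * F.
  by rewrite mulrA mulrDr !mulrA sq mul1r.
rewrite signE; ring.
Qed.
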